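(* Let $K$ be a Deming-$K_4$ graph. Then $K$ is an even subdivision of $K_4$ if and only if $K$ is $\alpha$-critical.
   Context: Graphs are finite and simple. For a graph $H$, $n(H)$ is its order, $\alpha(H)$ its independence number and $\nu(H)$ its matching number. $H$ is KE (König-Egerváry) if $\alpha(H)+\nu(H)=n(H)$; the null graph is KE. A graph $G$ is $\alpha$-critical if $\alpha(G-xy)=\alpha(G)+1$ for each edge $xy$ of $G$, where $G-xy$ is the graph obtained by deleting the edge $xy$. An even subdivision of a graph is obtained by subdividing each edge an even number (possibly zero) of times, i.e. replacing each edge by a path of odd length. A Deming-$K_4$ graph is a graph $K$ that contains a spanning even subdivision of $K_4$ and such that $K-\{x,y\}$ (delete both vertices) is KE for every edge $xy$ of $K$ that lies in at least one perfect matching of $K$. *)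

(* Defs.v *)
From mathcomp Require Import all_boot.
Set Implicit Arguments.
Unset Strict Implicit.
Unset Printing Implicit Defensive.

Record sgraph := SGraph {
  vertex :> finType;
  adj : rel vertex;
  adj_sym : symmetric adj;
  adj_irrefl : irreflexive adj }.

Section Graph.
Variable G : sgraph.
Implicit Types (S : {set G}) (M F : {set {set G}}) (x y : G).

Definition edges : {set {set G}} :=
  [set [set p.1; p.2] | p : G * G & adj p.1 p.2].

Definition stable S : bool := [forall x in S, forall y in S, ~~ adj x y].

Definition alpha : nat := \max_(S : {set G} | stable S) #|S|.

Definition matching M : bool := (M \subset edges) && trivIset M.

Definition nu : nat := \max_(M : {set {set G}} | matching M) #|M|.

Definition perfect_matching M : bool := matching M && (cover M == [set: G]).

Definition konig_egervary : Prop := alpha + nu = #|G|.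

Section Induced.
Variable S : {set G}.
Definition induced_rel : rel {x : G | x \in S} :=
  fun a b => adj (val a) (val b).
Fact induced_sym : symmetric induced_rel.
Proof. by move=> a b; rewrite /induced_rel adj_sym. Qed.
Fact induced_irrefl : irreflexive induced_rel.
Proof. by move=> a; rewrite /induced_rel adj_irrefl. Qed.
Definition induced : sgraph := SGraph induced_sym induced_irrefl.
End Induced.

Section Spanning.
Variable F : {set {set G}}.
Definition spanning_rel : rel G := fun a b => adj a b && ([set a; b] \in F).
Fact spanning_sym : symmetric spanning_rel.
Proof. by move=> a b; rewrite /spanning_rel adj_sym setUC. Qed.
Fact spanning_irrefl : irreflexive spanning_rel.
Proof. by move=> a; rewrite /spanning_rel adj_irrefl. Qed.
(* Same vertices as G, edge set F :&: edges; every spanning subgraph of G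
   arises in this way. *)
Definition spanning_subgraph : sgraph := SGraph spanning_sym spanning_irrefl.
End Spanning.

Definition delete_edge x y : sgraph :=
  spanning_subgraph (~: [set [set x; y]]).

Definition delete_vertices x y : sgraph := induced (~: [set x; y]).

End Graph.

Definition alpha_critical (G : sgraph) : Prop :=
  forall x y : G, adj x y -> alpha (delete_edge x y) = (alpha G).+1.

Section Complete.
Variable n : nat.
Definition complete_rel : rel 'I_n := fun i j => i != j.
Fact complete_sym : symmetric complete_rel.
Proof. by move=> i j; rewrite /complete_rel eq_sym. Qed.
Fact complete_irrefl : irreflexive complete_rel.
Proof. by move=> i; rewrite /complete_rel eqxx. Qed.
Definition complete : sgraph := SGraph complete_sym complete_irrefl.
End Complete.

(* G is, up to isomorphism, the graph obtained from H by replacing each edge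
   uv by the path f u, P u v, f v, where P u v lists the (possibly zero)
   subdividing vertices from the u-end to the v-end.  The values of P at
   non-adjacent pairs are irrelevant. *)
Record subdivision_by (H G : sgraph) (f : H -> G) (P : H -> H -> seq G)
  : Prop := SubdivisionBy {
  branch_inj : injective f;
  sub_rev : forall u v : H, adj u v -> P v u = rev (P u v);
  sub_uniq : forall u v : H, adj u v -> uniq (P u v);
  sub_not_branch : forall u v w : H, adj u v -> f w \notin P u v;
  sub_disjoint : forall (u v u' v' : H) (z : G), adj u v -> adj u' v' ->
    z \in P u v -> z \in P u' v' -> [set u; v] = [set u'; v'];
  sub_cover : forall z : G,
    (exists u : H, z = f u) \/ (exists u v : H, adj u v /\ z \in P u v);
  sub_adj : forall a b : G, adj a b <->
    exists u v : H, adj u v /\ infix [:: a; b] (f u :: rcons (P u v) (f v)) }.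

Definition even_subdivision (H G : sgraph) : Prop :=
  exists (f : H -> G) (P : H -> H -> seq G),
    subdivision_by f P /\ forall u v : H, adj u v -> ~~ odd (size (P u v)).

Definition deming_K4 (K : sgraph) : Prop :=
  (exists F : {set {set K}},
     even_subdivision (complete 4) (spanning_subgraph F)) /\
  (forall x y : K, adj x y ->
     (exists2 M : {set {set K}}, perfect_matching M & [set x; y] \in M) ->
     konig_egervary (delete_vertices x y)).

(* Main.v *)
Require Import Defs.
From mathcomp Require Import all_boot.
From mathcomp Require Import zify.
Set Implicit Arguments.
Unset Strict Implicit.
Unset Printing Implicit Defensive.

(** Write n for the order of K and S for its spanning even subdivision of the
    complete graph on four vertices.  Everything follows from comparing
    independence numbers with n/2.

    In an even subdivision of K4, alpha < n/2 ([alpha_K4_subdivision]): each of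
    the six subdivided edges contributes at most half of its inner vertices to
    a stable set, and one less when both of its ends are chosen.  With b chosen
    branch vertices the total is at most (n - 4)/2 + b - b(b - 1)/2, and
    b - b(b - 1)/2 <= 1.  On the other hand deleting any edge leaves a stable
    set of size n/2 ([alpha_delete_edge_K4_subdivision]), obtained by choosing
    every second vertex along each subdivided edge, the deleted edge being the one
    place where two consecutive vertices are chosen.  Since deleting an edge
    increases alpha by at most one, even subdivisions of K4 are alpha-critical.

    Conversely, S has a perfect matching, which is also one of K; removing the
    ends of one of its edges gives a KE graph on n - 2 vertices, which has a
    stable set of size (n - 2)/2, so that alpha K >= n/2 - 1
    ([deming_K4_alpha]).  If K is alpha-critical and some edge e of K is not in
    S, then S is a subgraph of K - e, hence
    n/2 - 1 >= alpha S >= alpha (K - e) = alpha K + 1 >= n/2, a contradiction.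
    So K = S. *)

(** * Independence number and matching number *)

Section StableSets.
Variable G : sgraph.
Implicit Types (S : {set G}) (x y : G).

Lemma stableP S :
  reflect {in S &, forall x y, ~~ adj x y} (stable S).
Proof.
apply: (iffP forall_inP) => [h x y xS yS|h x xS].
  by have /forall_inP := h x xS; apply.
by apply/forall_inP => y yS; apply: h.
Qed.

Lemma stable_alpha S : stable S -> #|S| <= alpha G.
Proof.
by move=> hS; apply: (leq_bigmax_cond (F := fun S : {set G} => #|S|)).
Qed.

Lemma alpha_leqP m :
  reflect (forall S, stable S -> #|S| <= m) (alpha G <= m).
Proof. exact: bigmax_leqP. Qed.

End StableSets.

Lemma alpha_spanning (G : sgraph) (F F' : {set {set G}}) :
  F \subset F' ->
  alpha (spanning_subgraph F') <= alpha (spanning_subgraph F).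
Proof.
move=> sFF'; apply/alpha_leqP => S /stableP hS.
apply: (stable_alpha (G := spanning_subgraph F)); apply/stableP => x y xS yS.
apply: contra (hS x y xS yS) => /andP[xy xyF].
by apply/andP; split=> //; apply: (subsetP sFF').
Qed.

(** A stable set of G - xy becomes stable in G once x is removed from it. *)
Lemma alpha_delete_edge (G : sgraph) (x y : G) :
  alpha (delete_edge x y) <= (alpha G).+1.
Proof.
apply/alpha_leqP => S /stableP hS.
rewrite (cardsD1 (x : G) S) -add1n leq_add ?leq_b1 //.
apply: stable_alpha; apply/stableP => p q.
rewrite !inE => /andP[px pS] /andP[qx qS].
apply: contra (hS p q pS qS) => pq; apply/andP; split=> //.
rewrite !inE; apply: contra px => /eqP /setP /(_ x).
by rewrite !inE eqxx /= (eq_sym x q) (negPf qx) orbF eq_sym => ->.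
Qed.

Lemma alpha_induced (G : sgraph) (S : {set G}) : alpha (induced S) <= alpha G.
Proof.
apply/alpha_leqP => T /stableP hT; rewrite -(card_imset _ val_inj).
apply: stable_alpha; apply/stableP => _ _ /imsetP[x xT ->] /imsetP[y yT ->].
exact: (hT x y).
Qed.

Lemma nu_leq_half (G : sgraph) : (nu G).*2 <= #|G|.
Proof.
rewrite -geq_half_double; apply/bigmax_leqP => M /andP[/subsetP sM tM].
rewrite geq_half_double -muln2; apply: leq_trans (max_card (mem (cover M))).
move: tM => /eqP <-.
rewrite (eq_bigr (fun=> 2)) ?sum_nat_const // => B /sM.
case/imsetP=> -[x y]; rewrite inE /= => xy ->.
by rewrite cards2; case: eqP xy => // ->; rewrite adj_irrefl.
Qed.

(** Since nu <= n/2, the equation alpha + nu = n forces alpha >= n/2. *)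
Lemma konig_egervary_alpha (G : sgraph) :
  konig_egervary G -> #|G| <= (alpha G).*2.
Proof. by rewrite /konig_egervary; have := nu_leq_half G; lia. Qed.

(** * Perfect matchings read off a list of the vertices *)

Section PairedSequences.
Variable G : sgraph.

Fixpoint paired (s : seq G) : bool :=
  if s is x :: t then
    if t is y :: t' then adj x y && paired t' else false
  else true.

Fixpoint pairs (s : seq G) : seq {set G} :=
  if s is x :: t then
    if t is y :: t' then [set x; y] :: pairs t' else [::]
  else [::].

(** Induction that consumes two vertices at a time, as [paired] does. *)
Lemma paired_ind (Q : seq G -> Prop) :
  Q [::] ->
  (forall x y s, adj x y -> paired s -> Q s -> Q [:: x, y & s]) ->
  forall s, paired s -> Q s.
Proof.
move=> Q0 QS s; have [n] := ubnP (size s); elim: n s => // n IH.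
case=> [|x [|y s]] //= sz /andP[xy ps].
by apply: QS => //; apply: IH => //; lia.
Qed.

Lemma paired_cat s t : paired s -> paired t -> paired (s ++ t).
Proof. by move=> ps pt; elim/paired_ind: s / ps => //= x y s -> _ ->. Qed.

Lemma paired_sorted s : sorted (@adj G) s -> ~~ odd (size s) -> paired s.
Proof.
have [n] := ubnP (size s); elim: n s => // n IH [|x [|y s]] //= sz.
case/andP=> -> ps; rewrite negbK => os; apply: IH => //; first by lia.
exact: path_sorted ps.
Qed.

Lemma cover_pairs s : paired s -> cover [set B in pairs s] = [set x in s].
Proof.
move=> ps; elim/paired_ind: s / ps => /= [|x y s _ _ IH].
  by rewrite !set_nil /cover big_set0.
rewrite set_cons /cover bigcup_setU big_set1 -/(cover _) IH.
by apply/setP=> z; rewrite !inE orbA.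
Qed.

Lemma perfect_matching_pairs s :
  paired s -> uniq s -> (forall x, x \in s) ->
  perfect_matching [set B in pairs s].
Proof.
move=> ps us cs; rewrite /perfect_matching /matching cover_pairs // -andbA.
apply/and3P; split; [| |by apply/eqP/setP=> x; rewrite !inE cs].
  apply/subsetP=> B; rewrite inE {us cs}.
  elim/paired_ind: s / ps B => //= x y s xy _ IH B.
  rewrite inE => /orP[/eqP->|/IH//].
  by apply/imsetP; exists (x, y); rewrite ?inE.
move: us {cs}; elim/paired_ind: s / ps => /= [_|x y s xy ps IH].
  by apply/trivIsetP => A B; rewrite inE.
rewrite inE negb_or => /and3P[/andP[_ xs] ys us].
rewrite set_cons; apply: trivIsetU; [|exact: IH|].
  by apply/trivIsetP => A B /set1P-> /set1P->; rewrite eqxx.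
rewrite cover_pairs // /cover big_set1 disjoint_subset.
apply/subsetP=> t; rewrite !inE; apply: contraL => ts.
by rewrite negb_or; apply/andP; split; apply: contraTneq ts => ->.
Qed.

End PairedSequences.

(** * Lists of consecutive vertices and of labels *)

Lemma infix_sorted (T : eqType) (e : rel T) s x y :
  sorted e s -> infix [:: x; y] s -> e x y.
Proof.
move=> es /infixP[s1 [s2 def_s]]; move: es.
by rewrite def_s sorted_cat_cons => /andP[_ /andP[]].
Qed.

Lemma sorted_infix (T : eqType) (e : rel T) s :
  (forall x y, infix [:: x; y] s -> e x y) -> sorted e s.
Proof.
elim: s => [|x [|y s] IH] // h; rewrite /= h; last first.
  by apply/infixP; exists [::], s.
apply: IH => p q /infixP[s1 [s2 def_s]]; apply: h.
by apply/infixP; exists (x :: s1), s2; rewrite def_s.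
Qed.

(** Sets of vertices are built by labelling a duplicate-free list of vertices:
    their traces on parts of the list and their size are then computed on lists
    of booleans. *)
Lemma exists_set_labels (T : finType) (s : seq T) (m : bitseq) :
  uniq s -> size m = size s ->
  exists S : {set T}, [seq x \in S | x <- s] = m.
Proof.
move=> us szm; exists [set x in mask m s].
case: s us szm => [_ /size0nil->|x0 s us szm] //.
apply: (@eq_from_nth _ false) => [|i]; rewrite size_map // => lt_i.
by rewrite (nth_map x0) // inE in_mask // mem_nth // index_uniq.
Qed.

Lemma card_count (T : finType) (s : seq T) (A : {set T}) :
  uniq s -> (forall x, x \in s) -> #|A| = count (mem A) s.
Proof.
move=> us cs; rewrite cardE -size_filter; apply: perm_size.
apply: uniq_perm; rewrite ?enum_uniq ?filter_uniq // => x.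
by rewrite mem_enum mem_filter /= cs andbT.
Qed.

Lemma card_size (T : finType) (s : seq T) :
  uniq s -> (forall x, x \in s) -> #|T| = size s.
Proof.
move=> us cs; rewrite cardT; apply: perm_size.
by apply: uniq_perm => [||x]; rewrite ?enum_uniq // mem_enum cs.
Qed.

Fixpoint alternating (b : bool) n : bitseq :=
  if n is n'.+1 then b :: alternating (~~ b) n' else [::].

Lemma size_alternating b n : size (alternating b n) = n.
Proof. by elim: n b => //= n IH b; rewrite IH. Qed.

Lemma count_alternating b n :
  count id (alternating b n) = if b then uphalf n else n./2.
Proof. by elim: n b => [[]|n IH []] //=; rewrite IH. Qed.

Lemma count_alternating_even b n :
  ~~ odd n -> (count id (alternating b n)).*2 = n.
Proof.
move=> on; rewrite count_alternating uphalf_half (negPf on) add0n if_same.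
exact: even_halfK.
Qed.

(** A set is stable along a path when consecutive labels are related by
    [nand]. *)
Definition nand : rel bool := fun p q => ~~ (p && q).

Lemma nand_sym p q : nand p q = nand q p.
Proof. by rewrite /nand andbC. Qed.

Lemma path_alternating p b n :
  nand p b -> path nand p (alternating b n).
Proof. by elim: n p b => //= n IH p b ->; apply: IH; case: b. Qed.

Lemma last_alternating p n : last p (alternating (~~ p) n) = p (+) odd n.
Proof.
elim: n p => [|n IH] p /=; first by rewrite addbF.
by rewrite IH; case: p; case: (odd n).
Qed.

(** Alternating from the complement of the first end, an even number of labels
    ends with the label of the first end; this is compatible with the second
    end unless both ends are chosen. *)
Lemma path_route_labels p q n :
  ~~ (p && q) -> ~~ odd n -> path nand p (rcons (alternating (~~ p) n) q).
Proof.
move=> pq on; rewrite rcons_path path_alternating ?last_alternating.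
  by rewrite (negPf on) addbF.
by case: p {pq}.
Qed.

(** The inner vertices p, even in number, split into pairs of neighbours, each
    containing at most one vertex of A.  If both ends are in A then one pair
    misses A: otherwise the choices, forced pair by pair from x, would put into
    A the neighbour of y. *)
Lemma count_route (G : sgraph) (A : {set G}) x y p :
  stable A -> path (@adj G) x (rcons p y) -> ~~ odd (size p) ->
  ((x \in A) && (y \in A) + count (mem A) p).*2 <= size p.
Proof.
move=> /stableP hA; have [n] := ubnP (size p).
elim: n p x => // n IH [|p1 [|p2 p]] x //= sz.
  rewrite andbT => xy _; case xA: (x \in A); case yA: (y \in A) => //.
  by have := hA x y xA yA; rewrite xy.
case/and3P=> xp p12 pp; rewrite negbK => ev.
have {IH} := IH p p2 _ pp ev; rewrite -ltnS => /(_ (ltnW sz)).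
have: ~~ ((x \in A) && (p1 \in A)).
  by apply/negP=> /andP[xA p1A]; have := hA x p1 xA p1A; rewrite xp.
have: ~~ ((p1 \in A) && (p2 \in A)).
  by apply/negP=> /andP[xA p1A]; have := hA p1 p2 xA p1A; rewrite p12.
by do 4!case: (_ \in A) => //=; lia.
Qed.

(** * Subdivided edges *)

Section Routes.
Variables (H G : sgraph) (f : H -> G) (P : H -> H -> seq G).
Hypothesis sub : subdivision_by f P.

Definition route u v : seq G := f u :: rcons (P u v) (f v).

Lemma route_rev u v : adj u v -> route v u = rev (route u v).
Proof. by move=> uv; rewrite /route (sub_rev sub uv) rev_cons rev_rcons. Qed.

Lemma route_path u v : adj u v -> sorted (@adj G) (route u v).
Proof.
by move=> uv; apply: sorted_infix => x y xy; apply/(sub_adj sub); exists u, v.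
Qed.

Lemma uniq_interiors (es : seq (H * H)) :
  all (fun e => adj e.1 e.2) es -> uniq [seq [set e.1; e.2] | e <- es] ->
  uniq (flatten [seq P e.1 e.2 | e <- es]).
Proof.
elim: es => //= e es IH /andP[ae aes] /andP[ne nes].
rewrite cat_uniq (sub_uniq sub) // IH // andbT /=.
apply: contra ne => /hasP[x /flatten_mapP[e' e's xe'] xe].
apply/mapP; exists e' => //; apply: (sub_disjoint sub) xe xe' => //.
exact: (allP aes).
Qed.

End Routes.

(** * Even subdivisions of K4 *)

Lemma two_more_branches (u v : 'I_4) :
  u != v -> exists w z, uniq [:: u; v; w; z].
Proof.
move=> uv; have: size (filter (predC (mem [:: u; v])) (enum 'I_4)) = 2.
  have count_uv : count (mem [:: u; v]) (enum 'I_4) = 2.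
    rewrite -size_filter; apply: (@perm_size _ _ [:: u; v]); apply: uniq_perm.
    - by rewrite filter_uniq ?enum_uniq.
    - by rewrite /= inE uv.
    - by move=> i; rewrite mem_filter mem_enum andbT.
  have := count_predC (mem [:: u; v]) (enum 'I_4).
  by rewrite size_filter size_enum_ord count_uv => /(@addnI 2 _ 2).
case def_s: filter => [|w [|z []]] // _; exists w, z.
have in_s i : i \in [:: w; z] -> i \notin [:: u; v].
  by rewrite -def_s mem_filter => /andP[].
have us : uniq [:: w; z] by rewrite -def_s filter_uniq ?enum_uniq.
rewrite -[_ :: _]/([:: u; v] ++ [:: w; z]) cat_uniq us /= inE uv /=.
by rewrite orbF negb_or !in_s ?inE ?eqxx ?orbT.
Qed.

Section K4Subdivision.
Variables (G : sgraph) (f : complete 4 -> G).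
Variable P : complete 4 -> complete 4 -> seq G.
Hypothesis sub : subdivision_by f P.
Hypothesis evenP : forall u v : complete 4, adj u v -> ~~ odd (size (P u v)).

(** The order of the pieces is chosen so that cutting the list into consecutive
    pairs gives a perfect matching: each of the six pieces is a path with an
    even number of vertices. *)
Definition spanning_seq u v w z :=
  route f P u v ++ route f P w z ++ P u w ++ P u z ++ P v w ++ P v z.

Section Labelled.
Variables u v w z : complete 4.

Definition six_edges : seq (complete 4 * complete 4) :=
  [:: (u, v); (w, z); (u, w); (u, z); (v, w); (v, z)].

Lemma spanning_seq_perm :
  perm_eq (spanning_seq u v w z)
   ([:: f u; f v; f w; f z] ++
    flatten [seq P e.1 e.2 | e <- six_edges]).
Proof.
apply/permP=> a; rewrite /spanning_seq /route /= !count_cat /=.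
by rewrite -!cats1 !count_cat /=; clear; lia.
Qed.

Hypothesis uvwz : uniq [:: u; v; w; z].

Lemma branches_total i : i \in [:: u; v; w; z].
Proof.
have [||_ ->] := @uniq_min_size _ [:: u; v; w; z] (enum 'I_4) uvwz.
- by move=> j; rewrite mem_enum.
- by rewrite size_enum_ord.
by rewrite mem_enum.
Qed.

Lemma branches_adj :
  [/\ adj u v, adj w z & [/\ adj u w, adj u z, adj v w & adj v z]].
Proof.
move: uvwz; rewrite /= !inE !negb_or /adj /= /complete_rel.
by case/and3P=> /and3P[? ? ?] /andP[? ?] /andP[? _].
Qed.

Lemma spanning_seq_uniq : uniq (spanning_seq u v w z).
Proof.
rewrite (perm_uniq spanning_seq_perm) cat_uniq.
have [? ? [? ? ? ?]] := branches_adj.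
apply/and3P; split.
- by rewrite (map_inj_uniq (branch_inj sub) [:: u; v; w; z]).
- apply/hasPn => x /flatten_mapP[e es xe].
  apply/negP => /(@mapP _ _ f [:: u; v; w; z])[i _ xi]; move: xe; apply/negP.
  rewrite xi; apply: (sub_not_branch sub); move: es; rewrite !inE.
  by do 5?[case/orP]; move=> /eqP-> /=.
apply: (uniq_interiors sub); first by apply/and5P; split=> //=; apply/and3P.
move: uvwz; rewrite /= !inE !negb_or -!andbA.
case/and4P=> uv uw uz /and4P[vw vz wz _].
have sw (a b : complete 4) : a != b -> (a == b) = false /\ (b == a) = false.
  by move=> /negPf ab; rewrite (eq_sym b) ab.
have [[uv1 uv2] [uw1 uw2] [uz1 uz2]] :=
  And3 (sw _ _ uv) (sw _ _ uw) (sw _ _ uz).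
have [[vw1 vw2] [vz1 vz2] [wz1 wz2]] :=
  And3 (sw _ _ vw) (sw _ _ vz) (sw _ _ wz).
have neq (a b c d : complete 4) :
    ~~ [&& (a == c) || (a == d) & (b == c) || (b == d)] ->
    [set a; b] != [set c; d].
  apply: contraNneq => E; move/setP: (E) => /(_ a); move/setP: E => /(_ b).
  by rewrite !inE !eqxx orbT => <- <-.
by do !(apply/andP; split => //); apply: neq;
  rewrite ?(eqxx, uv1, uv2, uw1, uw2, uz1, uz2, vw1, vw2, vz1, vz2, wz1, wz2).
Qed.

Lemma mem_spanning_seq x : x \in spanning_seq u v w z.
Proof.
rewrite (perm_mem spanning_seq_perm) mem_cat; apply/orP.
case: (sub_cover sub x) => [[i ->]|[i [j [ij xij]]]].
  by left; apply: (map_f f (branches_total i)).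
right; apply/flatten_mapP.
have xji : x \in P j i by rewrite (sub_rev sub ij) mem_rev.
move: (branches_total i) (branches_total j) ij xij xji; rewrite !inE.
have Mem a b : x \in P a b -> (a, b) \in six_edges ->
    exists2 e, e \in six_edges & x \in P e.1 e.2.
  by exists (a, b).
do 3?[case/orP]; move=> /eqP->; do 3?[case/orP]; move=> /eqP->;
  rewrite ?adj_irrefl // => _ h1 h2;
  first [by apply: (Mem _ _ h1); rewrite !inE eqxx ?orbT |
         by apply: (Mem _ _ h2); rewrite !inE eqxx ?orbT].
Qed.

Lemma spanning_seq_paired : paired (spanning_seq u v w z).
Proof.
have [uv wz [uw uz vw vz]] := branches_adj.
have rp i j : adj i j -> paired (route f P i j).
  move=> ij; apply: paired_sorted; first exact: (route_path sub).
  by rewrite /= size_rcons /= negbK evenP.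
have ip i j : adj i j -> paired (P i j).
  move=> ij; apply: paired_sorted; last exact: evenP.
  have /= := route_path sub ij; rewrite rcons_path => /andP[+ _].
  exact: path_sorted.
by rewrite /spanning_seq; do !apply: paired_cat; auto.
Qed.

End Labelled.

(** After [count_route], what remains is that a set of b branch vertices, which
    contains all ends of b(b - 1)/2 subdivided edges, satisfies
    b - b(b - 1)/2 <= 1; this is checked for each of the sixteen sets. *)
Lemma alpha_K4_subdivision : (alpha G).+1.*2 <= #|G|.
Proof.
have [w [z uo]] := two_more_branches (isT : (ord0 : 'I_4) != ord_max).
have [uv wz [uw uz vw vz]] := branches_adj uo.
have us := spanning_seq_uniq uo; have cs := mem_spanning_seq uo.
have bound (A : {set G}) : stable A -> (#|A|.+1).*2 <= #|G|.
  move=> hA; rewrite (card_count A us cs) (card_size us cs).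
  rewrite (perm_size (spanning_seq_perm _ _ _ _)).
  rewrite (permP (spanning_seq_perm _ _ _ _)) /= !count_cat !size_cat /=.
  have cr i j (ij : adj i j) := count_route hA (route_path sub ij) (evenP ij).
  move: (cr _ _ uv) (cr _ _ wz) (cr _ _ uw) (cr _ _ uz) (cr _ _ vw) (cr _ _ vz).
  by clear; do 4!case: (_ \in A) => /=; lia.
(* This makes the truncated predecessor below exact. *)
have b0 : 2 <= #|G|.
  have := bound set0; rewrite cards0; apply; apply/stableP => x y.
  by rewrite inE.
suff: alpha G <= #|G|./2.-1 by move: b0; clear; lia.
by apply/alpha_leqP => A /bound; clear; lia.
Qed.

(** Let xy lie on the subdivided edge from u to v, and let w, z be the other
    branch vertices.  Choose x and y and alternate from them towards u and v.
    The path from u to v has evenly many vertices, so u and v get the same label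
    t.  Give w the label ~~ t and z the label false: then u and v are the only
    branch vertices that may both be chosen, and the five other subdivided edges
    can be filled alternately.  If t holds, the route from u to v has one chosen
    vertex more than half and the route from w to z one less; otherwise both
    have exactly half. *)
Lemma alpha_delete_edge_K4_subdivision (x y : G) :
  adj x y -> #|G| <= (alpha (delete_edge x y)).*2.
Proof.
case/(sub_adj sub) => u [v [uv xy]].
have [w [z uvwz]] := two_more_branches uv.
have us := spanning_seq_uniq uvwz; have cs := mem_spanning_seq uvwz.
have [_ wz [uw uz vw vz]] := branches_adj uvwz.
case/infixP: xy => s1 [s2] def_uv.
change (route f P u v = s1 ++ [:: x, y & s2]) in def_uv.
have odd_s12 : odd (size s1) = odd (size s2).
  have := congr1 size def_uv; have := evenP uv.
  by rewrite /route /= size_rcons size_cat /=; clear; lia.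
pose t := ~~ odd (size s1).
(* The block for s1 and x ends with the label of x, which is true by the choice
   of t; the block for y and s2 starts with the label of y. *)
pose bits_uv := alternating t (size s1).+1 ++ alternating true (size s2).+1.
pose bits_wz := ~~ t :: rcons (alternating t (size (P w z))) false.
pose bits := alternating (~~ t).
have size_uv : size (route f P u v) = size bits_uv.
  by rewrite def_uv /bits_uv !size_cat !size_alternating /= !addnS.
have size_wz : size (route f P w z) = size bits_wz.
  by rewrite /= !size_rcons size_alternating.
have [|T labels] := exists_set_labels (m := bits_uv ++ bits_wz ++
    bits (size (P u w)) ++ bits (size (P u z)) ++
    bits (size (P v w)) ++ bits (size (P v z))) us.
  rewrite /spanning_seq ![size (route _ _ _ _ ++ _)]size_cat size_uv size_wz.
  by rewrite !size_cat !size_alternating.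
have cardT : #|T|.*2 = #|G|.
  have count_T s : count (mem T) s = count id [seq p \in T | p <- s].
    by rewrite count_map.
  rewrite (card_count T us cs) count_T labels (card_size us cs).
  have count_uv : (count id bits_uv).*2 = (size s1 + size s2).+2 + t.*2.
    rewrite count_cat !count_alternating /t odd_s12; move: odd_s12; clear.
    by case: (boolP (odd (size s2))) => /=; lia.
  rewrite /spanning_seq def_uv /route /bits_wz /bits; move: count_uv.
  have halves i j (ij : adj i j) b := count_alternating_even b (evenP ij).
  move: (halves _ _ wz t) (halves _ _ uw (~~ t)) (halves _ _ uz (~~ t)).
  move: (halves _ _ vw (~~ t)) (halves _ _ vz (~~ t)).
  rewrite !(count_cat, size_cat, size_rcons) /= -!cats1 !(count_cat, size_cat).
  do 7!move: (count _ (alternating _ _)) => ?.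
  by case: (t) => /=; clear; lia.
move/eqP: labels; rewrite /spanning_seq /bits !map_cat.
rewrite !eqseq_cat ?size_map ?size_alternating //.
case/and5P=> /eqP Tuv /eqP Twz /eqP Tuw /eqP Tuz /andP[/eqP Tvw /eqP Tvz].
have Tu : (f u \in T) = t by move: Tuv; rewrite /bits_uv /= => -[].
have Tv : (f v \in T) = t.
  have := congr1 (last true) Tuv.
  rewrite /= map_rcons last_rcons last_cat /= (last_alternating true).
  by rewrite /t odd_s12.
have [Tw Tz] : (f w \in T) = ~~ t /\ (f z \in T) = false.
  have := congr1 (last true) Twz; move: Twz.
  by rewrite /= map_rcons /= !last_rcons => -[].
(* Making e symmetric and true on xy reduces stability in the graph without xy
   to sortedness of each of the routes, in either direction. *)
pose e p q := nand (p \in T) (q \in T) || ([set p; q] == [set x; y]).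
have e_sym p q : e p q = e q p by rewrite /e nand_sym setUC.
have e_map s : sorted nand [seq p \in T | p <- s] -> sorted e s.
  by rewrite sorted_map; apply: sub_sorted => p q pq; apply/orP; left.
have e_uv : sorted e (route f P u v).
  move: Tuv; rewrite def_uv -cat_rcons map_cat => /eqP.
  rewrite eqseq_cat ?size_map ?size_rcons ?size_alternating //.
  case/andP=> /eqP T1 /eqP T2.
  rewrite cat_rcons sorted_cat_cons; apply/and3P; split.
  - by apply: e_map; rewrite T1 /= path_alternating // /nand; case: (t).
  - by rewrite /e eqxx orbT.
  - by apply: (e_map (y :: s2)); rewrite T2 /= path_alternating.
have e_part i j : adj i j -> ~~ ((f i \in T) && (f j \in T)) ->
    [seq p \in T | p <- P i j] = alternating (~~ (f i \in T)) (size (P i j)) ->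
    sorted e (route f P i j).
  move=> ij nij Tij; apply: e_map; rewrite /= map_rcons Tij.
  exact: path_route_labels (evenP ij).
have e_wz : sorted e (route f P w z).
  apply: e_part => //; rewrite ?Tw ?Tz ?andbF // negbK.
  by move: Twz; rewrite /bits_wz /= map_rcons => -[_] /rcons_inj[].
have e_uw : sorted e (route f P u w) by apply: e_part; rewrite ?Tu ?Tw // andbN.
have e_uz : sorted e (route f P u z) by apply: e_part; rewrite ?Tu ?Tz // andbF.
have e_vw : sorted e (route f P v w) by apply: e_part; rewrite ?Tv ?Tw // andbN.
have e_vz : sorted e (route f P v z) by apply: e_part; rewrite ?Tv ?Tz // andbF.
have e_rev i j :
    adj i j -> sorted e (route f P i j) -> sorted e (route f P j i).
  move=> ij; rewrite (route_rev sub ij) rev_sorted.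
  by apply: sub_sorted => p q; rewrite e_sym.
have e_all i j : adj i j -> sorted e (route f P i j).
  move: (branches_total uvwz i) (branches_total uvwz j); rewrite !inE.
  do 3?[case/orP]; move=> /eqP->; do 3?[case/orP]; move=> /eqP->;
    rewrite ?adj_irrefl //; solve [auto].
rewrite -cardT leq_double; apply: (stable_alpha (G := delete_edge x y)).
apply/stableP => p q pT qT; apply/negP => /andP[pq].
rewrite !inE => /negPf npq; have [i [j [ij]]] := (sub_adj sub p q).1 pq.
by move/(infix_sorted (e_all i j ij)); rewrite /e /nand npq pT qT.
Qed.

End K4Subdivision.

(** The KE condition on a Deming-K4 graph applies to edges that lie in a perfect
    matching; the first pair of [spanning_seq] is such an edge. *)
Lemma K4_subdivision_matched_edge (G : sgraph) :
  even_subdivision (complete 4) G ->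
  exists x y : G, adj x y /\
    exists2 M : {set {set G}}, perfect_matching M & [set x; y] \in M.
Proof.
case=> f [P [sub ev]].
have [w [z uo]] := two_more_branches (isT : (ord0 : 'I_4) != ord_max).
have paired_s := spanning_seq_paired sub ev uo.
have := perfect_matching_pairs paired_s
  (spanning_seq_uniq sub uo) (mem_spanning_seq sub uo).
case def_s: (spanning_seq f P ord0 ord_max w z) paired_s => [|x [|y s']] //.
move=> /andP[xy _] pm.
exists x, y; split=> //; exists [set B in pairs [:: x, y & s']] => //.
by rewrite inE /= inE eqxx.
Qed.

(** * Deming-K4 graphs *)

(** Stable sets of the KE graph K - x - y, for an edge xy of a perfect matching,
    are stable in K. *)
Lemma deming_K4_alpha (K : sgraph) : deming_K4 K -> #|K| <= (alpha K).+1.*2.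
Proof.
case=> [[F subF] KE].
have [x [y [/andP[xy _] [M pM xyM]]]] := K4_subdivision_matched_edge subF.
have pK : @perfect_matching K M.
  case/andP: pM => /andP[/subsetP sM tM] cM.
  apply/andP; split=> //; apply/andP; split=> //.
  apply/subsetP=> B /sM /imsetP[p]; rewrite inE => /andP[pp _] ->.
  by apply/imsetP; exists p; rewrite ?inE.
have := konig_egervary_alpha (KE x y xy (ex_intro2 _ _ M pK xyM)).
rewrite card_sig -(cardsC [set x; y]) doubleS -add2n => le_card.
apply: leq_add; first by rewrite cards2; case: (x != y).
apply: leq_trans le_card _.
by rewrite leq_double; apply: alpha_induced.
Qed.

Theorem corollary2p8 (K : sgraph) (hK : deming_K4 K) :
  even_subdivision (complete 4) K <-> alpha_critical K.
Proof.
split=> [[f [P [sub ev]]] x y xy|crit].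
  have := alpha_K4_subdivision sub ev.
  have := alpha_delete_edge_K4_subdivision sub ev xy.
  by have := alpha_delete_edge x y; lia.
have lo := deming_K4_alpha hK.
have [[F [f [P [sub ev]]]] _] := hK.
have inF (x y : K) : adj x y -> [set x; y] \in F.
  move=> xy; apply: contraLR lo => xyF.
  have sF : F \subset ~: [set [set x; y]].
    by apply/subsetP=> B BF; rewrite !inE; apply: contraNneq xyF => <-.
  have := alpha_spanning sF; rewrite (crit x y xy : alpha _ = _).
  by have := alpha_K4_subdivision sub ev; rewrite /=; lia.
(* The subdivision data of the spanning subgraph also describes K, since only
   [sub_adj] mentions adjacency. *)
exists f, P; split=> //; case: sub => h1 h2 h3 h4 h5 h6 h7.
split=> // x y; rewrite -(h7 x y) /= /spanning_rel.
by split=> [xy|/andP[]//]; apply/andP; split=> //; apply: inF.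
Qed.
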